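(* For every finite complete graph $K$, every integer $m\geq 3$, and every edge probability measure $\mu\in\Delta^K$, \[2m\cdot\beta(\mu;C_m)+2\cdot\beta(\mu;P_{m+1})\leq \frac{2}{m^{m-1}}.\] Moreover, for every finite complete graph $K$, every integer $m\ge 3$ and every $\mu\in\Delta^K$, equality holds in the inequality \[2m\cdot\beta(\mu;C_m)+\beta(\mu;P_{m+1})\leq \frac{2}{m^{m-1}}\] if and only if $\mu$ is the uniform measure on the edge set of a copy of $C_m$ in $K$ (that is, there is a cycle $C\subseteq K$ on $m$ vertices with $\mu(e)=1/m$ for every $e\in E(C)$ and $\mu(e)=0$ for every other edge $e$ of $K$).
   Context: All graphs are finite and simple. $P_k$ and $C_k$ denote, respectively, the path and the cycle on $k$ vertices (so $P_{m+1}$ has $m$ edges). For a finite complete graph $K$, an edge probability measure on $K$ is a function $\mu:E(K)\to[0,1]$ with $\sum_{e\in E(K)}\mu(e)=1$; $\Delta^K$ denotes the set of all edge probability measures on $K$. For a subgraph $H'\subseteq K$, put $\mu(H')=\prod_{e\in E(H')}\mu(e)$. For a graph $H$, let $\mathcal C(K,H)$ be the set of all unlabeled, not necessarily induced copies of $H$ in $K$ (i.e. subgraphs of $K$ isomorphic to $H$), and define $\beta(\mu;H)=\sum_{H'\in\mathcal C(K,H)}\mu(H')$. *)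

(* Defs.v *)
From mathcomp Require Import all_boot all_order all_algebra reals.

Set Implicit Arguments.
Unset Strict Implicit.
Unset Printing Implicit Defensive.

Import Order.TTheory GRing.Theory Num.Theory.
Local Open Scope ring_scope.

Record sgraph := SGraph {
  vertex :> finType;
  adj : rel vertex;
  adj_sym : symmetric adj;
  adj_irr : irreflexive adj
}.

Definition complete (G : sgraph) : Prop :=
  forall x y : G, x != y -> adj x y.

Definition edges (G : sgraph) : {set {set G}} :=
  [set e | [exists x, exists y, adj x y && (e == [set x; y])]].

Definition edge (G : sgraph) := {e : {set G} | e \in edges G}.

(* A subgraph is a pair (vertex set, edge set) such that the endpoints of every
   edge in the edge set belong to the vertex set. *)
Definition is_subgraph (G : sgraph) (S : {set G} * {set edge G}) : bool :=
  [forall e in S.2, val e \subset S.1].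

Definition sub_adj (G : sgraph) (S : {set G} * {set edge G}) : rel G :=
  fun x y => [exists e in S.2, val e == [set x; y]].

(* f is an isomorphism from H onto the graph S: a bijection from the vertices
   of H onto S.1 preserving both adjacency and non-adjacency, the latter with
   respect to S and not to G, so that copies need not be induced in G. *)
Definition sub_iso (G H : sgraph) (S : {set G} * {set edge G}) : bool :=
  [exists f : {ffun H -> G},
    [&& injectiveb f, f @: [set: H] == S.1 &
        [forall x, forall y, adj x y == sub_adj S (f x) (f y)]]].

Definition copies (G H : sgraph) : {set {set G} * {set edge G}} :=
  [set S | is_subgraph S && sub_iso H S].

Definition edge_prob_measure (R : realType) (G : sgraph) (mu : edge G -> R)
  : Prop :=
  (forall e, 0 <= mu e <= 1) /\ \sum_e mu e = 1.

Definition weight (R : realType) (G : sgraph) (mu : edge G -> R)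
  (S : {set G} * {set edge G}) : R := \prod_(e in S.2) mu e.

Definition beta (R : realType) (G : sgraph) (mu : edge G -> R) (H : sgraph)
  : R := \sum_(S in copies G H) weight mu S.

Definition path_adj (k : nat) : rel 'I_k :=
  fun i j => (j == i.+1 :> nat) || (i == j.+1 :> nat).

Lemma path_adj_sym k : symmetric (@path_adj k).
Proof. by move=> i j; rewrite /path_adj orbC. Qed.

Lemma path_adj_irr k : irreflexive (@path_adj k).
Proof. by move=> i; rewrite /path_adj orbb ltn_eqF. Qed.

Definition path_graph (k : nat) : sgraph :=
  SGraph (@path_adj_sym k) (@path_adj_irr k).

(* For k >= 3 this is the cycle C_k; the condition i != j only matters for
   k = 1, and for k <= 2 the graph is not a cycle. *)
Definition cycle_adj (k : nat) : rel 'I_k :=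
  fun i j => (i != j) &&
    ((j == i.+1 %% k :> nat) || (i == j.+1 %% k :> nat))%N.

Lemma cycle_adj_sym k : symmetric (@cycle_adj k).
Proof. by move=> i j; rewrite /cycle_adj orbC eq_sym. Qed.

Lemma cycle_adj_irr k : irreflexive (@cycle_adj k).
Proof. by move=> i; rewrite /cycle_adj eqxx. Qed.

Definition cycle_graph (k : nat) : sgraph :=
  SGraph (@cycle_adj_sym k) (@cycle_adj_irr k).

(* Main.v *)
Require Import Defs.
From mathcomp Require Import all_boot all_order all_algebra reals.
From mathcomp Require Import polyrcf ring lra zify.

Import Order.TTheory GRing.Theory Num.Theory.
Local Open Scope ring_scope.

(** Let g x y be the mass of the edge xy, and let a leaf be a labelled path Z on
    m vertices, weighted by the product of its edge masses.  Give Z the value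
      V(Z) = cyc(Z)/m + (mass leaving the head + mass leaving the last vertex)/2,
    with cyc(Z) the mass of the m edges of the cycle closing Z.  Extending leaves
    by one vertex counts labelled paths with m edges; averaging over the m
    rotations of a cycle and Cauchy's inequality show that the cyc-part counts
    labelled cycles.  So twice m times beta(C_m) plus twice beta(P_(m+1)) is at
    most the weighted sum of V over the leaves.

    To bound that sum, grow a path from a single edge, each new vertex being
    attached at the left end with weight th and at the right end with weight
    1 - th.  The factors of one growth history are the th-mixtures of the masses
    available at both ends, and the last factor is V; AM-GM bounds the product of
    m - 1 factors by their sum.  Let H(s) be the mass of the edges touching s.
    The mass available at s is H(s) minus the th-mixture of H over the two
    one-vertex trimmings of s, so the sum of the factors telescopes, and its
    part in th at a leaf is a Bernstein polynomial whose coefficients are the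
    vertex masses.  Integrating over th in [0, 1] leaves
      m^m sum_Z w(Z) V(Z) (1/m + slack(Z)) <= 2
    with slack(Z) >= 0, which is the bound.  Equality forces the number of
    labelled P_(m+1) and the slack of every leaf of positive weight to vanish;
    for a cycle C of positive weight this says that C carries all the mass, and
    the equality case of AM-GM makes mu constant on C. *)

(** * AM-GM and Bernstein polynomials *)


(** AM-GM for [x] and [k] copies of [u]. In terms of the mean [y] it says that [y ^+ k.+1] lies
    above its tangent at [u]; in the induction the gap for [k.+1] is [y] times the gap for [k] plus
    a multiple of [(y - u) ^+ 2]. *)
Lemma mulX_le_AGM (R : realFieldType) (k : nat) (x u : R) :
  0 <= x -> 0 <= u -> x * u ^+ k <= ((x + k%:R * u) / k.+1%:R) ^+ k.+1.
Proof.
move=> x0 u0; set y := (_ / _).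
have k0 : k.+1%:R != 0 :> R by rewrite pnatr_eq0.
have y0 : 0 <= y by rewrite divr_ge0 // addr_ge0 // mulr_ge0.
have -> : x = k.+1%:R * y - k%:R * u by rewrite /y mulrC divfK // addrK.
clearbody y; clear k0 x0 x.
suff H : 0 <= y ^+ k.+1 - k.+1%:R * u ^+ k * y + k%:R * u ^+ k.+1.
  rewrite -subr_ge0; apply: le_trans H _; rewrite le_eqVlt; apply/orP; left.
  by apply/eqP; rewrite !exprS; ring.
elim: k => [|k IH]; first by rewrite expr0 !expr1 mulr1 mul1r subrr mul0r addr0.
have -> : y ^+ k.+2 - k.+2%:R * u ^+ k.+1 * y + k.+1%:R * u ^+ k.+2 =
  y * (y ^+ k.+1 - k.+1%:R * u ^+ k * y + k%:R * u ^+ k.+1)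
  + k.+1%:R * u ^+ k * (y - u) ^+ 2.
  by rewrite !exprS -!natr1; ring.
apply: addr_ge0; apply: mulr_ge0 => //; last exact: sqr_ge0.
by apply: mulr_ge0; rewrite ?exprn_ge0.
Qed.

(** One step of the growth induction: a factor [x] is paid for by lowering the budget from [t] to
    [t - x]. The budget may become negative, hence the truncation at 0; [0 < k] makes the power
    vanish in that case. *)
Lemma mulX_le_max (R : realFieldType) (k : nat) (x t : R) :
  (0 < k)%N -> 0 <= x ->
  x * (Num.max (t - x) 0 / k%:R) ^+ k <= (Num.max t 0 / k.+1%:R) ^+ k.+1.
Proof.
move=> k0 x0; case: (lerP (t - x) 0) => [le|lt].
  rewrite mul0r expr0n eqn0Ngt k0 mulr0 exprn_ge0 // divr_ge0 //.
  by rewrite le_max lexx orbT.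
have t0 : 0 < t by lra.
rewrite (max_l (ltW t0)).
have := @mulX_le_AGM _ k _ ((t - x) / k%:R) x0 _.
rewrite [k%:R * _]mulrC divfK ?pnatr_eq0 ?lt0n_neq0 //.
by rewrite [x + _]addrC subrK; apply; rewrite divr_ge0 // ltW.
Qed.

Section Bernstein.
Variable R : rcfType.

(* De Casteljau recursion for the Bernstein polynomial with coefficients c. *)
Fixpoint bern (n : nat) (c : nat -> R) : {poly R} :=
  if n is n'.+1 then 'X * bern n' (fun i => c i.+1) + (1 - 'X) * bern n' c
  else (c 0%N)%:P.

Lemma eq_bern n c c' :
  (forall i, (i <= n)%N -> c i = c' i) -> bern n c = bern n c'.
Proof.
elim: n c c' => [|n IH] c c' E /=; first by rewrite E.
by rewrite (IH (fun i => c i.+1) (fun i => c' i.+1)) ?(IH c c') // => i le;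
   rewrite E // ltnW.
Qed.

Lemma bernB n c c' : bern n (fun i => c i - c' i) = bern n c - bern n c'.
Proof.
elim: n c c' => [|n IH] c c' /=; first by rewrite polyCB.
rewrite (IH (fun i => c i.+1) (fun i => c' i.+1)) IH; ring.
Qed.

(** By the product rule the recursion contributes the difference of the shifted and the unshifted
    polynomial, which by linearity is the polynomial with the differences as coefficients. *)
Lemma deriv_bern n c :
  (bern n.+1 c)^`() = n.+1%:R *: bern n (fun i => c i.+1 - c i).
Proof.
elim: n c => [|n IH] c.
  rewrite /= !derivE scale1r polyCB; ring.
rewrite [bern n.+2 c]/= derivD !derivM IH IH !derivE.
rewrite -/(bern n.+1 (fun i => c i.+1)) -/(bern n.+1 c).
rewrite [bern n.+1 (fun i => c i.+1 - c i)]/=.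
have -> : n.+2%:R = 1 + n.+1%:R :> R by rewrite -natr1 addrC.
have E : bern n.+1 (fun i => c i.+1) - bern n.+1 c =
  'X * bern n (fun i => c i.+2 - c i.+1) + (1 - 'X) * bern n (fun i => c i.+1 - c i).
  by rewrite -bernB.
rewrite -!mul_polyC polyCD.
transitivity (1 * (bern n.+1 (fun i => c i.+1) - bern n.+1 c) + (n.+1%:R)%:P * ('X * bern n (fun i => c i.+2 - c i.+1) + (1 - 'X) * bern n (fun i => c i.+1 - c i))).
  ring.
rewrite E; ring.
Qed.

Lemma bern_at0 n c : (bern n c).[0] = c 0%N.
Proof.
elim: n c => [|n IH] c /=; first by rewrite hornerC.
by rewrite !hornerE IH; ring.
Qed.

Lemma bern_at1 n c : (bern n c).[1] = c n.
Proof.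
elim: n c => [|n IH] c /=; first by rewrite hornerC.
by rewrite !hornerE IH; ring.
Qed.

(** Partial sums are the coefficients because their consecutive differences, which [deriv_bern]
    produces, give back [c]. *)
Definition bern_primitive n (c : nat -> R) : {poly R} :=
  n.+1%:R^-1 *: bern n.+1 (fun i => \sum_(j < i) c j).

Lemma deriv_bern_primitive n (c : nat -> R) : (bern_primitive n c)^`() = bern n c.
Proof.
rewrite derivZ deriv_bern scalerA mulVf ?pnatr_eq0 // scale1r.
by apply: eq_bern => i _; rewrite big_ord_recr /= addrC addrK.
Qed.

(* Every Bernstein basis polynomial of degree n has integral 1/(n+1) over [0, 1]. *)
Lemma bern_primitive_diff n (c : nat -> R) : (bern_primitive n c).[1] - (bern_primitive n c).[0] =
  n.+1%:R^-1 * \sum_(i < n.+1) c i.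
Proof.
by rewrite !hornerZ bern_at0 bern_at1 big_ord0 mulr0 subr0.
Qed.

(** The mean value theorem replaces integration of the pointwise bound over [0, 1]. *)
Lemma poly_le_integral (q : {poly R}) (K : R) :
  (forall t, 0 <= t <= 1 -> q^`().[t] <= K) -> q.[1] - q.[0] <= K.
Proof.
move=> le; have [c c01 ->] := @poly_mvt _ 0 1 q ltr01.
rewrite subr0 mulr1 le //; move: c01; rewrite in_itv /= => /andP[a b].
by rewrite !ltW.
Qed.

End Bernstein.

(** * Weighted sums over labelled paths *)


Section PathSums.
Variables (R : rcfType) (V : finType) (g : V -> V -> R) (x0 : V).
Hypothesis g_ge0 : forall x y, 0 <= g x y.

Implicit Types (s : seq V) (h : seq V -> R).

Definition path_weight s : R :=
  \prod_(i < (size s).-1) g (nth x0 s i) (nth x0 s i.+1).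

(** The index [q] counts edges; for [q > 0] every path occurs once in each direction. *)
Definition path_sum q h : R :=
  \sum_(t : q.+1.-tuple V | uniq t) path_weight t * h t.

Definition ext_left h s : R := \sum_(v | v \notin s) g v (head x0 s) * h (v :: s).

Definition ext_right h s : R :=
  \sum_(v | v \notin s) g (last x0 s) v * h (rcons s v).

Definition init s := if s is x :: s' then belast x s' else [::].

Lemma init_rcons s v : init (rcons s v) = s.
Proof. by case: s => // x s; rewrite /= belast_rcons. Qed.

Lemma size_init s : size (init s) = (size s).-1.
Proof. by case: s => //= x s; rewrite size_belast. Qed.

Lemma nth_init s i : (i < (size s).-1)%N -> nth x0 (init s) i = nth x0 s i.
Proof.
by case/lastP: s => // s v; rewrite init_rcons size_rcons nth_rcons => ->.
Qed.

Lemma path_weight_ge0 s : 0 <= path_weight s.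
Proof. exact: prodr_ge0. Qed.

Lemma path_weight_cons v s :
  (0 < size s)%N -> path_weight (v :: s) = g v (head x0 s) * path_weight s.
Proof. by case: s => // x s _; rewrite /path_weight /= big_ord_recl. Qed.

Lemma path_weight_rcons s v :
  (0 < size s)%N -> path_weight (rcons s v) = path_weight s * g (last x0 s) v.
Proof.
case: s => // x s _; rewrite /path_weight size_rcons /= big_ord_recr /=.
congr (_ * _); last by rewrite -rcons_cons !nth_rcons /= ltnSn ltnn eqxx (last_nth x0).
apply: eq_bigr => i _; rewrite -rcons_cons !nth_rcons /= ltnS (ltnW (ltn_ord i)).
by rewrite ltn_ord.
Qed.

Lemma eq_path_sum q h h' :
  (forall s, size s = q.+1 -> uniq s -> h s = h' s) -> path_sum q h = path_sum q h'.
Proof.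
by move=> E; apply: eq_bigr => t ut; rewrite E // size_tuple.
Qed.

Lemma le_path_sum q h h' :
  (forall s, size s = q.+1 -> uniq s -> h s <= h' s) ->
  path_sum q h <= path_sum q h'.
Proof.
move=> E; apply: ler_sum => t ut.
by rewrite ler_wpM2l ?path_weight_ge0 ?E ?size_tuple.
Qed.

Lemma path_sumZ q a h : path_sum q (fun s => a * h s) = a * path_sum q h.
Proof. by rewrite mulr_sumr; apply: eq_bigr => t _; rewrite mulrCA. Qed.

Lemma path_sumD q h h' :
  path_sum q (fun s => h s + h' s) = path_sum q h + path_sum q h'.
Proof. by rewrite -big_split; apply: eq_bigr => t _; rewrite mulrDr. Qed.

(** Splitting off the head is a bijection from longer paths to pairs of a path and a new vertex off
    it. *)
Lemma path_sum_ext_left q h : path_sum q (ext_left h) = path_sum q.+1 h.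
Proof.
rewrite /path_sum; under eq_bigr do rewrite mulr_sumr.
rewrite pair_big_dep /=.
rewrite (reindex (fun p : q.+1.-tuple V * V => cons_tuple p.2 p.1)) /=; last first.
  exists (fun t : q.+2.-tuple V => (behead_tuple t, thead t)) => [[t v] _|t _].
    by congr pair; apply: val_inj.
  by apply: val_inj; rewrite [in RHS](tuple_eta t).
apply: eq_big => [[t v]|[t v] _] /=; first by rewrite andbC.
by rewrite path_weight_cons ?size_tuple // mulrA [path_weight t * _]mulrC.
Qed.

Lemma path_sum_ext_right q h : path_sum q (ext_right h) = path_sum q.+1 h.
Proof.
rewrite /path_sum; under eq_bigr do rewrite mulr_sumr.
rewrite pair_big_dep /=.
rewrite (reindex (fun p : q.+1.-tuple V * V => rcons_tuple p.1 p.2)) /=; last first.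
  exists (fun t : q.+2.-tuple V =>
    (belast_tuple (thead t) (behead_tuple t), last (thead t) t)) => [[t v] _|t _].
    congr pair; last by rewrite /= last_rcons.
    apply: val_inj; case: t => -[|x s] //= i.
    by rewrite /thead (tnth_nth x0) /= belast_rcons.
  apply: val_inj; case: t => -[|x s] //= i.
  by rewrite /thead (tnth_nth x0) /= -lastI.
apply: eq_big => [[t v]|[t v] _] /=; first by rewrite rcons_uniq andbC.
by rewrite path_weight_rcons ?size_tuple // mulrA.
Qed.

End PathSums.

(** * Growing paths *)


Section Growth.
Variables (R : rcfType) (V : finType) (g : V -> V -> R) (x0 : V).
Hypotheses (g_sym : forall x y, g x y = g y x) (g_diag : forall x, g x x = 0).
Hypotheses (g_ge0 : forall x y, 0 <= g x y) (g_sum : \sum_x \sum_y g x y = 2).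

Local Notation path_sum := (path_sum R V g x0).
Local Notation ext_left := (ext_left R V g x0).
Local Notation ext_right := (ext_right R V g x0).
Local Notation init := (init V).

Implicit Types (s : seq V) (h L : seq V -> R).

Lemma sum_pair_D1 (P : pred V) x : P x ->
  \sum_(a | P a) \sum_(b | P b) g a b =
  \sum_(a | P a && (a != x)) \sum_(b | P b && (b != x)) g a b
  + 2 * \sum_(b | P b && (b != x)) g x b.
Proof.
move=> Px; rewrite (bigD1 x) //= (bigD1 (P := P) x) //= g_diag add0r.
under [X in _ + X]eq_bigr do rewrite (bigD1 x) //=.
rewrite big_split /= [X in _ + (X + _)](eq_bigr (fun a => g x a)) => [|a _]; last exact: g_sym.
ring.
Qed.

(* The total weight of the edges with at least one endpoint in s. *)
Definition touched s : R := 1 - 2^-1 * \sum_(x | x \notin s) \sum_(y | y \notin s) g x y.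

Lemma touched_le1 s : touched s <= 1.
Proof.
rewrite gerBl mulr_ge0 ?invr_ge0 ?ler0n // sumr_ge0 // => x _.
exact: sumr_ge0.
Qed.

(** An edge from the head to a vertex off [s] is exactly an edge that touches [s] but not
    [behead s]. *)
Lemma ext_left1 s : (0 < size s)%N -> uniq s ->
  ext_left (fun=> 1) s = touched s - touched (behead s).
Proof.
case: s => // x s _ /= /andP[xs us]; rewrite /touched /ext_left.
rewrite (sum_pair_D1 (fun a => a \notin s) x) //.
have E : (fun a => a \notin x :: s) =1 (fun a => (a \notin s) && (a != x)).
  by move=> a; rewrite inE negb_or andbC.
rewrite (eq_bigl _ _ E) (eq_bigl _ _ E).
under [in RHS]eq_bigr do rewrite (eq_bigl _ _ E).
under eq_bigr do rewrite mulr1 g_sym.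
by field.
Qed.

Lemma ext_right1 s : (0 < size s)%N -> uniq s ->
  ext_right (fun=> 1) s = touched s - touched (init s).
Proof.
case/lastP: s => // s x _; rewrite rcons_uniq => /andP[xs us].
rewrite init_rcons /touched /ext_right last_rcons.
rewrite (sum_pair_D1 (fun a => a \notin s) x) //.
have E : (fun a => a \notin rcons s x) =1 (fun a => (a \notin s) && (a != x)).
  by move=> a; rewrite mem_rcons inE negb_or andbC.
rewrite (eq_bigl _ _ E) (eq_bigl _ _ E).
under [in RHS]eq_bigr do rewrite (eq_bigl _ _ E).
under eq_bigr do rewrite mulr1.
by field.
Qed.

Lemma touched1 x : touched [:: x] = \sum_y g x y.
Proof.
have E := sum_pair_D1 predT x isT; rewrite g_sum /= in E; rewrite /touched.
have -> : \sum_(a | a \notin [:: x]) \sum_(b | b \notin [:: x]) g a b =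
          \sum_(a | a != x) \sum_(b | b != x) g a b.
  apply: eq_big => [a|a _]; first by rewrite inE.
  by apply: eq_bigl => b; rewrite inE.
rewrite [RHS](bigD1 x) //= g_diag add0r; lra.
Qed.

Section Theta.
Variable th : R.

Definition ext_mix h s := th * ext_left h s + (1 - th) * ext_right h s.

Definition trim h s := th * h (behead s) + (1 - th) * h (init s).

Lemma ext_mixZ a h s : ext_mix (fun s' => a * h s') s = a * ext_mix h s.
Proof.
rewrite /ext_mix /ext_left /ext_right.
under eq_bigr do rewrite mulrCA.
under [X in _ + _ * X]eq_bigr do rewrite mulrCA.
rewrite -!mulr_sumr; ring.
Qed.

Lemma ext_mixD h h' s :
  ext_mix (fun s' => h s' + h' s') s = ext_mix h s + ext_mix h' s.
Proof.
rewrite /ext_mix /ext_left /ext_right.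
under eq_bigr do rewrite mulrDr.
under [X in _ + _ * X]eq_bigr do rewrite mulrDr.
rewrite !big_split /=; ring.
Qed.

Lemma eq_ext_mix h h' s : h =1 h' -> ext_mix h s = ext_mix h' s.
Proof.
move=> E; congr (_ * _ + _ * _); apply: eq_bigr => v _; by rewrite E.
Qed.

Lemma le_ext_mix h h' s : 0 <= th <= 1 -> (forall s', h s' <= h' s') ->
  ext_mix h s <= ext_mix h' s.
Proof.
move=> /andP[t0 t1] le; rewrite lerD // ler_wpM2l ?subr_ge0 //;
by apply: ler_sum => v _; rewrite ler_wpM2l.
Qed.

Lemma ext_mix1_ge0 s : 0 <= th <= 1 -> 0 <= ext_mix (fun=> 1) s.
Proof.
move=> /andP[t0 t1]; rewrite addr_ge0 // mulr_ge0 ?subr_ge0 // sumr_ge0 // => v _;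
by rewrite mulr1.
Qed.

Lemma ext_mix1 s : (0 < size s)%N -> uniq s ->
  ext_mix (fun=> 1) s = touched s - trim touched s.
Proof.
by move=> s0 us; rewrite /ext_mix ext_left1 // ext_right1 // /trim; ring.
Qed.

(** The value may depend on the parent path, which is [behead s] or [init s] according to the end at
    which the child [s] was extended. *)
Lemma path_sum_mix q (F : seq V -> seq V -> R) :
  path_sum q (fun s => ext_mix (F s) s) =
  path_sum q.+1 (fun s => th * F (behead s) s + (1 - th) * F (init s) s).
Proof.
transitivity (th * path_sum q (ext_left (fun s => F (behead s) s))
              + (1 - th) * path_sum q (ext_right (fun s => F (init s) s))).
  rewrite -!path_sumZ -path_sumD; apply: eq_path_sum => s _ _.
  rewrite /ext_mix /ext_right; congr (_ + _ * _).
  by apply: eq_bigr => v _; rewrite init_rcons.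
by rewrite path_sum_ext_left path_sum_ext_right -!path_sumZ -path_sumD.
Qed.

Variables (c : R) (L : seq V -> R).
Hypotheses (c_ge0 : 0 <= c) (L_ge0 : forall s, 0 <= L s).

(* Total value of growing the path s by r vertices.  The accumulator t starts at
   some T and loses every factor x met on the way, so a leaf carries
   (prod of the x) * (T - sum of the x), to which AM-GM applies. *)
Fixpoint grow r t s : R :=
  if r is r'.+1 then c * ext_mix (grow r' (t - c * ext_mix (fun=> 1) s)) s
  else c * L s * (t - c * L s).

(** The accumulator is only shifted on the way down and enters a leaf linearly. This lets the
    accumulators coming from the two possible parents of a path be merged into one. *)
Lemma grow_affine r t1 t2 s :
  grow r (th * t1 + (1 - th) * t2) s = th * grow r t1 s + (1 - th) * grow r t2 s.
Proof.
elim: r t1 t2 s => [|r IH] t1 t2 s /=; first by ring.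
set e := c * ext_mix (fun=> 1) s.
have -> : th * t1 + (1 - th) * t2 - e = th * (t1 - e) + (1 - th) * (t2 - e) by ring.
rewrite (eq_ext_mix _ _ s (fun s' => IH _ _ s')) ext_mixD !ext_mixZ; ring.
Qed.

(** The inductive bound on the children depends only on their common accumulator, so it comes out of
    [ext_mix] and leaves the factor [x], which [mulX_le_max] absorbs. *)
Lemma grow_le r t s : 0 <= th <= 1 ->
  grow r t s <= (Num.max t 0 / r.+2%:R) ^+ r.+2.
Proof.
move=> t01; elim: r t s => [|r IH] t s /=.
  apply: le_trans (@mulX_le_max _ 1 (c * L s) t _ _) => //; last by rewrite mulr_ge0.
  by rewrite ler_wpM2l ?mulr_ge0 // divr1 expr1 le_max lexx.
set x := c * ext_mix (fun=> 1) s.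
apply: le_trans (@mulX_le_max _ r.+2 x t _ _) => //; last by rewrite mulr_ge0 ?ext_mix1_ge0.
rewrite {2}/x -mulrA ler_wpM2l // [leRHS]mulrC -ext_mixZ; move: x => x.
by apply: le_ext_mix => // s'; rewrite mulr1 IH.
Qed.

(** The [q]-fold iterate of [trim] applied to [touched]; on a path with [q] edges only single
    vertices remain. *)
Fixpoint trims q s : R :=
  if q is q'.+1 then th * trims q' (behead s) + (1 - th) * trims q' (init s)
  else touched s.

(** Telescoping: extending [s] subtracts [c * (touched s - trim touched s)] and leaves
    [c + c * (trims q s - touched s)]; mixing this over the two parents of a child gives the same
    form with [q.+1]. *)
Lemma path_sum_grow r q :
  path_sum q (fun s => grow r (c + c * (trims q s - trim touched s)) s) =
  c ^+ r * path_sum (q + r) (fun s =>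
    c * L s * (c + c * (trims (q + r) s - trim touched s) - c * L s)).
Proof.
elim: r q => [|r IH] q; first by rewrite addn0 mul1r.
rewrite addnS -addSn exprS -mulrA -IH /= path_sumZ; congr (_ * _).
pose F s := grow r (c + c * (trims q s - touched s)).
rewrite (eq_path_sum _ _ _ _ _ _ (fun s => ext_mix (F s) s)) => [|s ss us].
  rewrite path_sum_mix; apply: eq_path_sum => s _ _.
  rewrite -grow_affine; congr (grow _ _ _); rewrite /= /trim; ring.
rewrite /F ext_mix1 ?ss //; congr (ext_mix (grow r _) s); ring.
Qed.

Lemma path_sum1 : path_sum 1 (fun=> 1) = 2.
Proof.
rewrite -path_sum_ext_left -g_sum /path_sum [RHS]exchange_big /=.
rewrite (reindex (fun x => [tuple x])) /=; last first.
  exists (fun t : 1.-tuple V => thead t) => [x _|t _] //.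
  by apply: val_inj; case: t => -[|y []] // i; rewrite /thead (tnth_nth x0).
apply: eq_bigr => x _; rewrite /path_weight big_ord0 mul1r /ext_left.
rewrite [RHS](bigD1 x) //= g_diag add0r; apply: eq_big => y; rewrite ?inE //.
by rewrite mulr1.
Qed.

(** There are [M - 1] extension factors, the leaf factor and the remaining accumulator. With the
    budget [c = M.+1] AM-GM bounds their product by 1, so the total is at most the weight 2 of the
    oriented single edges. *)
Lemma growth_bound M : 0 <= th <= 1 -> (0 < M)%N -> c = M.+1%:R ->
  c ^+ M.+1 * path_sum M (fun s => L s * (1 + trims M s - trim touched s - L s)) <= 2.
Proof.
move=> t01; case: M => // M _ cE.
have := path_sum_grow M 1; rewrite add1n => E.
have -> : c ^+ M.+2 * path_sum M.+1
    (fun s => L s * (1 + trims M.+1 s - trim touched s - L s)) =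
  c ^+ M * path_sum M.+1 (fun s =>
    c * L s * (c + c * (trims M.+1 s - trim touched s) - c * L s)).
  rewrite !exprSr -!mulrA; congr (_ * _); rewrite -!path_sumZ; apply: eq_path_sum => s _ _.
  ring.
rewrite -E -path_sum1; apply: le_path_sum => // s _ _.
(* On a single edge [trims 1 s] is [trim touched s], so the accumulator starts at [c]. *)
rewrite /= -/(trim touched s) subrr mulr0 addr0.
apply: le_trans (grow_le _ _ _ t01) _.
by rewrite max_l // cE divff ?expr1n // pnatr_eq0.
Qed.

End Theta.
End Growth.

(** * Averaging over the growth parameter *)


Section LeafBound.
Variables (R : rcfType) (V : finType) (g : V -> V -> R) (x0 : V).
Hypotheses (g_sym : forall x y, g x y = g y x) (g_diag : forall x, g x x = 0).
Hypotheses (g_ge0 : forall x y, 0 <= g x y) (g_sum : \sum_x \sum_y g x y = 2).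

Local Notation path_weight := (path_weight R V g x0).
Local Notation path_sum := (path_sum R V g x0).
Local Notation ext_left := (ext_left R V g x0).
Local Notation ext_right := (ext_right R V g x0).
Local Notation init := (init V).
Local Notation touched := (touched R V g).
Local Notation trim := (trim R V).
Local Notation trims := (trims R V g).

Implicit Types s : seq V.

Definition mass x : R := \sum_y g x y.

Definition cyc s : R :=
  \sum_(i < size s) g (nth x0 s i) (nth x0 s (i.+1 %% size s)).

Definition inner s : R := 2^-1 * \sum_(x in s) \sum_(y in s) g x y.

Definition leaf s : R :=
  cyc s / (size s)%:R + 2^-1 * (ext_left (fun=> 1) s + ext_right (fun=> 1) s).

Lemma cyc_ge0 s : 0 <= cyc s.
Proof. exact: sumr_ge0. Qed.

Lemma ext_left1_ge0 s : 0 <= ext_left (fun=> 1) s.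
Proof. by apply: sumr_ge0 => v _; rewrite mulr1. Qed.

Lemma ext_right1_ge0 s : 0 <= ext_right (fun=> 1) s.
Proof. by apply: sumr_ge0 => v _; rewrite mulr1. Qed.

Lemma leaf_ge0 s : 0 <= leaf s.
Proof.
rewrite addr_ge0 ?mulr_ge0 ?invr_ge0 ?ler0n ?cyc_ge0 //.
by rewrite addr_ge0 ?ext_left1_ge0 ?ext_right1_ge0.
Qed.

(** [behead] shifts the vertex indices and [init] keeps them, so trimming follows the de Casteljau
    recursion. *)
Lemma trims_bern th q s : size s = q.+1 ->
  trims th q s = (bern R q (fun i => mass (nth x0 s i))).[th].
Proof.
elim: q s => [|q IH] s ss.
  by case: s ss => [|x []] //= _; rewrite hornerC touched1.
rewrite /= !hornerE IH ?size_behead ?ss // IH ?size_init ?ss //.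
rewrite (eq_bern _ _ (fun i => mass (nth x0 (behead s) i))
                     (fun i => mass (nth x0 s i.+1))) => [|i _]; last by rewrite nth_behead.
rewrite (eq_bern _ _ (fun i => mass (nth x0 (init s) i))
                     (fun i => mass (nth x0 s i))) // => i le.
by rewrite nth_init // ss.
Qed.

Lemma average_bound M : (0 < M)%N ->
  M.+1%:R ^+ M.+1 * path_sum M (fun s => leaf s *
    (1 + M.+1%:R^-1 * \sum_(i < M.+1) mass (nth x0 s i)
       - 2^-1 * (touched (init s) + touched (behead s)) - leaf s)) <= 2.
Proof.
move=> M0.
(* Coefficients of [trim touched s] as a Bernstein polynomial of degree 1; index 0 carries the
   weight [1 - th], hence [init]. *)
pose b s i := touched (if i is 0%N then init s else behead s).
(* A primitive in [th] of the bracket in [growth_bound] for the leaf value [leaf]; [Q] is then a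
   primitive of its whole left side. *)
pose P s : {poly R} := (1 - leaf s) *: 'X
  + bern_primitive R M (fun i => mass (nth x0 s i))
  - bern_primitive R 1 (b s).
pose Q : {poly R} := M.+1%:R ^+ M.+1 *:
  \sum_(t : M.+1.-tuple V | uniq t) (path_weight t * leaf t) *: P t.
have QE x : Q.[x] = M.+1%:R ^+ M.+1 * path_sum M (fun s => leaf s * (P s).[x]).
  rewrite hornerZ horner_sum; congr (_ * _); apply: eq_bigr => t _.
  by rewrite hornerZ mulrA.
have dQE x : Q^`().[x] =
    M.+1%:R ^+ M.+1 * path_sum M (fun s => leaf s * (P s)^`().[x]).
  rewrite derivZ raddf_sum hornerZ horner_sum; congr (_ * _); apply: eq_bigr => t _.
  by rewrite /= derivZ hornerZ mulrA.
have := poly_le_integral R Q 2; rewrite !QE -mulrBr.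
have -> : path_sum M (fun s => leaf s * (P s).[1])
          - path_sum M (fun s => leaf s * (P s).[0]) = path_sum M (fun s => leaf s *
    (1 + M.+1%:R^-1 * \sum_(i < M.+1) mass (nth x0 s i)
       - 2^-1 * (touched (init s) + touched (behead s)) - leaf s)).
  rewrite -[X in _ - X]mul1r -mulNr -path_sumZ -path_sumD.
  apply: eq_path_sum => s _ _; rewrite mulN1r -mulrBr; congr (_ * _).
  have := bern_primitive_diff R M (fun i => mass (nth x0 s i)).
  have := bern_primitive_diff R 1 (b s); rewrite big_ord_recl big_ord1 /P /b /=.
  move: (bern_primitive _ _ _) (bern_primitive _ _ _) => p1 p2 <- <-.
  rewrite !hornerD !hornerN !hornerZ !hornerX; ring.
apply => th th01; rewrite dQE.
apply: le_trans (growth_bound R V g x0 g_sym g_diag g_ge0 g_sum th M.+1%:R leaf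
  _ leaf_ge0 M th01 M0 erefl) => //.
rewrite ler_wpM2l ?exprn_ge0 // le_eqVlt; apply/orP; left; apply/eqP.
apply: eq_path_sum => s ss _; congr (_ * _).
rewrite /P derivB derivD derivZ derivX !deriv_bern_primitive trims_bern // /trim.
have E : (bern R 1 (b s)).[th] = th * touched (behead s) + (1 - th) * touched (init s).
  by rewrite /= !hornerE.
by rewrite hornerD hornerN hornerD hornerZ hornerC E; ring.
Qed.

Lemma sum_nth_uniq (T : zmodType) (F : V -> T) s : uniq s ->
  \sum_(x in s) F x = \sum_(i < size s) F (nth x0 s i).
Proof. by move=> us; rewrite -big_uniq // (big_nth x0) big_mkord. Qed.

(** Among the edges touching [s], those with both ends in [s] are counted twice and the others
    once. *)
Lemma sum_mass s : uniq s ->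
  \sum_(i < size s) mass (nth x0 s i) = touched s + inner s.
Proof.
move=> us; rewrite -(sum_nth_uniq _ mass) // /touched /inner.
have E1 : \sum_(x in s) mass x =
    \sum_(x in s) \sum_(y in s) g x y + \sum_(x in s) \sum_(y | y \notin s) g x y.
  by rewrite -big_split; apply: eq_bigr => x _; rewrite /mass (bigID (mem s)).
have E2 : \sum_(x | x \notin s) \sum_y g x y =
    \sum_(x | x \notin s) \sum_(y in s) g x y + \sum_(x | x \notin s) \sum_(y | y \notin s) g x y.
  by rewrite -big_split; apply: eq_bigr => x _; rewrite /mass (bigID (mem s)).
have E3 : \sum_(x | x \notin s) \sum_(y in s) g x y =
          \sum_(x in s) \sum_(y | y \notin s) g x y.
  by rewrite exchange_big; apply: eq_bigr => x _; apply: eq_bigr => y _.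
have := g_sum; rewrite (bigID (mem s)) /= -/(mass _) E2 E3.
rewrite [X in X + _]E1 => E; rewrite E1; lra.
Qed.

(** On at least three vertices the cyclic predecessor and successor of a vertex differ, so both
    terms can be kept in its row of the double sum and the others dropped. *)
Lemma inner_ge_cyc s : uniq s -> (2 < size s)%N -> cyc s <= inner s.
Proof.
move=> us; rewrite /cyc /inner (sum_nth_uniq _ _ s us).
under [X in _ -> _ <= _ * X]eq_bigr do rewrite (sum_nth_uniq _ _ s us).
set m := size s => m2; case: m m2 => [|[|[|p]]] // _.
pose z (i : 'I_p.+3) := nth x0 s i.
have E : \sum_(i < p.+3) g (nth x0 s i) (nth x0 s (i.+1 %% p.+3)) =
         \sum_i g (z i) (z (i + 1)).
  by apply: eq_bigr => i _; rewrite /z /= addn1.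
have E' : \sum_i g (z i) (z (i - 1)) = \sum_i g (z i) (z (i + 1)).
  rewrite (reindex_inj (addIr 1)) /=; apply: eq_bigr => i _.
  by rewrite addrK g_sym.
rewrite E ler_pdivlMl // mulr_natl mulr2n -[X in X + _]E' -big_split /=.
apply: ler_sum => i _; rewrite (bigD1 (i - 1)) // (bigD1 (i + 1)) /=; last first.
  by rewrite (inj_eq (addrI i)) -val_eqE /= !modn_small ?subSS.
by rewrite -/(z _) -/(z _) -[leLHS]addr0 -addrA lerD // lerD // sumr_ge0.
Qed.

(** What the bracket in [average_bound] has beyond [1 / size s]. It weighs the edges missing [s] and
    the chords of the closed cycle. *)
Definition slack s : R :=
  ((size s).-1%:R * (1 - touched s) + (inner s - cyc s)) / (size s)%:R.

Lemma slack_ge0 s : uniq s -> (2 < size s)%N -> 0 <= slack s.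
Proof.
move=> us s2; rewrite divr_ge0 // addr_ge0 ?subr_ge0 ?inner_ge_cyc //.
by rewrite mulr_ge0 // subr_ge0 touched_le1.
Qed.

Lemma leaf_bound M : (1 < M)%N ->
  path_sum M leaf + M.+1%:R * path_sum M (fun s => leaf s * slack s)
    <= 2 / M.+1%:R ^+ M.
Proof.
move=> M1; have := average_bound M (ltnW M1).
rewrite (eq_path_sum _ _ _ _ _ _ (fun s =>
  M.+1%:R^-1 * (leaf s + M.+1%:R * (leaf s * slack s)))) => [|s ss us].
  rewrite path_sumZ path_sumD path_sumZ exprSr -mulrA mulVKf ?pnatr_eq0 //.
  by rewrite ler_pdivlMr ?exprn_gt0 // mulrC.
have E := sum_mass s us; rewrite ss in E; rewrite E {2}/leaf ext_left1 ?ss // ext_right1 ?ss // /slack ss /=.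
rewrite -[in RHS]natr1 -[in LHS]natr1; field.
by rewrite natr1 pnatr_eq0.
Qed.

End LeafBound.

(** * Rotating cycles *)


Section Rotations.
Variables (R : rcfType) (V : finType) (g : V -> V -> R) (x0 : V).
Hypothesis g_ge0 : forall x y, 0 <= g x y.

Local Notation path_weight := (path_weight R V g x0).
Local Notation path_sum := (path_sum R V g x0).
Local Notation cyc := (cyc R V g x0).

Lemma sum_uniq_tuple n (F : seq V -> R) :
  \sum_(t : n.-tuple V | uniq t) F t =
  \sum_(f : {ffun 'I_n -> V} | injectiveb f) F (mktuple f).
Proof.
rewrite (reindex (fun f : {ffun 'I_n -> V} => mktuple f)) //=.
exists (fun t : n.-tuple V => [ffun i => tnth t i]) => [f _|t _].
  by apply/ffunP => i; rewrite ffunE tnth_mktuple.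
by apply: eq_from_tnth => i; rewrite tnth_mktuple ffunE.
Qed.

Lemma path_weight_mktuple n (f : {ffun 'I_n.+1 -> V}) :
  path_weight (mktuple f) = \prod_(i < n) g (f (widen_ord (leqnSn n) i)) (f (lift ord0 i)).
Proof.
(* Eliminating the size equation replaces [size (mktuple f)] by [n.+1] in the index type of the
   product. *)
rewrite /path_weight; case: _ / (esym (size_tuple (mktuple f))) => /=.
apply: eq_bigr => i _.
by rewrite -(nth_mktuple f x0 (widen_ord _ i)) -(nth_mktuple f x0 (lift ord0 i)).
Qed.

Variable p : nat.
Implicit Types f : {ffun 'I_p.+3 -> V}.

(** Addition in ['I_p.+3] is modulo [p.+3], so [i + 1] closes the cycle. *)
Definition closed_weight f : R := \prod_i g (f i) (f (i + 1)).

Definition open_weight f (k : 'I_p.+3) : R := \prod_(i | i != k) g (f i) (f (i + 1)).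

Lemma lift0_add1 (i : 'I_p.+2) : lift ord0 i = widen_ord (leqnSn _) i + 1.
Proof. by apply: val_inj; rewrite /= modnDmr addn1 modn_small //; exact: (ltn_ord i). Qed.

Lemma path_weight_open f : path_weight (mktuple f) = open_weight f ord_max.
Proof.
rewrite path_weight_mktuple /open_weight [RHS]big_mkcond [RHS]big_ord_recr /= eqxx mulr1.
apply: eq_bigr => i _; rewrite lift0_add1.
by rewrite -val_eqE /= ltn_eqF.
Qed.

Lemma cyc_mktuple f : cyc (mktuple f) = \sum_i g (f i) (f (i + 1)).
Proof.
rewrite /cyc; case: _ / (esym (size_tuple (mktuple f))).
apply: eq_bigr => i _; rewrite -!(nth_mktuple f x0); congr (g _ (nth _ _ _)).
by rewrite /= modnDmr addn1.
Qed.

Lemma open_closed f k : g (f k) (f (k + 1)) * open_weight f k = closed_weight f.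
Proof. by rewrite /closed_weight (bigD1 k). Qed.

(** With [c j * d j = P] for every [j], the terms [d k * c j] and [d j * c k] have product [P ^+ 2],
    so their sum is at least [2 * P]; summing over all pairs gives the Cauchy bound without dividing
    by masses that may be 0. *)
Lemma sum_open_closed f :
  p.+3%:R ^+ 2 * closed_weight f <=
  (\sum_k open_weight f k) * \sum_j g (f j) (f (j + 1)).
Proof.
pose c j := g (f j) (f (j + 1)); pose d := open_weight f; set P := closed_weight f.
have P0 : 0 <= P by exact: prodr_ge0.
have d0 k : 0 <= d k by apply: prodr_ge0.
have c0 j : 0 <= c j by exact: g_ge0.
have cd j k : 2 * P <= d k * c j + d j * c k.
  have x0' : 0 <= d k * c j by rewrite mulr_ge0.
  have y0 : 0 <= d j * c k by rewrite mulr_ge0.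
  rewrite -(@ler_pXn2r _ 2) ?nnegrE ?addr_ge0 ?mulr_ge0 //.
  have -> : (2 * P) ^+ 2 = 4 * (d k * c j) * (d j * c k).
    transitivity (4 * (c k * d k) * (c j * d j)); last by ring.
    rewrite /c /d !open_closed -/P; ring.
  rewrite -subr_ge0; apply: le_trans (sqr_ge0 (d k * c j - d j * c k)) _.
  by rewrite le_eqVlt; apply/orP; left; apply/eqP; ring.
rewrite mulr_suml; under [leRHS]eq_bigr do rewrite mulr_sumr.
rewrite -(@ler_pM2l _ 2) // [leRHS]mulr_natl mulr2n [X in _ <= _ + X]exchange_big /=.
rewrite -big_split /=; under [leRHS]eq_bigr do rewrite -big_split /=.
apply: (@le_trans _ _ (\sum_(k < p.+3) \sum_(j < p.+3) 2 * P)).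
  rewrite !sumr_const !card_ord -mulr_natl -[_ *+ p.+3]mulr_natl le_eqVlt.
  by apply/orP; left; apply/eqP; ring.
by apply: ler_sum => k _; apply: ler_sum => j _; exact: cd.
Qed.

Lemma sum_rotate (k : 'I_p.+3) (F : {ffun 'I_p.+3 -> V} -> R) :
  \sum_(f : {ffun 'I_p.+3 -> V} | injectiveb f) F f =
  \sum_(f : {ffun 'I_p.+3 -> V} | injectiveb f) F [ffun i => f (i + k)].
Proof.
rewrite (reindex (fun f : {ffun 'I_p.+3 -> V} => [ffun i => f (i + k)])) /=; last first.
  exists (fun f => [ffun i => f (i - k)]) => f _; apply/ffunP => i; rewrite !ffunE.
    by rewrite subrK.
  by rewrite addrK.
apply: eq_bigl => f; apply/injectiveP/injectiveP => fi i j.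
  by move=> E; apply: (addIr (- k)); apply: fi; rewrite !ffunE !subrK.
by rewrite !ffunE => /fi /addIr.
Qed.

Lemma closed_le_path_sum :
  \sum_(f : {ffun 'I_p.+3 -> V} | injectiveb f) closed_weight f <=
  path_sum p.+2 (fun s => cyc s / (size s)%:R).
Proof.
rewrite /path_sum (sum_uniq_tuple _ (fun s => path_weight s * (cyc s / (size s)%:R))).
pose C f := \sum_i g (f i) (f (i + 1)).
have -> : \sum_(f : {ffun 'I_p.+3 -> V} | injectiveb f)
    path_weight (mktuple f) * (cyc (mktuple f) / (size (mktuple f))%:R) =
  p.+3%:R^-1 * \sum_(f : {ffun 'I_p.+3 -> V} | injectiveb f) open_weight f ord_max * C f.
  rewrite mulr_sumr; apply: eq_bigr => f _.
  by rewrite path_weight_open cyc_mktuple size_tuple /C; ring.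
rewrite -(@ler_pM2l _ (p.+3%:R ^+ 2)) ?exprn_gt0 // expr2 -[leRHS]mulrA mulVKf ?pnatr_eq0 //.
have -> : p.+3%:R * \sum_(f : {ffun 'I_p.+3 -> V} | injectiveb f) open_weight f ord_max * C f
  = \sum_(f : {ffun 'I_p.+3 -> V} | injectiveb f) (\sum_k open_weight f k) * C f.
  transitivity (\sum_(k < p.+3) \sum_(f : {ffun 'I_p.+3 -> V} | injectiveb f)
     open_weight f k * C f); last first.
    by rewrite exchange_big; apply: eq_bigr => f _; rewrite mulr_suml.
  set S := (X in _ * X); rewrite [RHS](eq_bigr (fun=> S)) => [|k _].
    by rewrite sumr_const card_ord mulr_natl.
  (* Rotation by [k - ord_max] moves the omitted edge from [ord_max] to [k] and preserves the cycle
     mass. *)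
  rewrite /S; symmetry; rewrite (sum_rotate (k - ord_max)); apply: eq_bigr => f _.
  have E i : i + 1 + (k - ord_max) = i + (k - ord_max) + 1 by rewrite addrAC.
  rewrite /open_weight /C; congr (_ * _).
    rewrite [RHS](reindex_inj (addIr (k - ord_max))) /=; apply: eq_big => i.
      by rewrite -(inj_eq (addIr (k - ord_max)) i) [ord_max + _]addrC subrK.
    by rewrite !ffunE E.
  rewrite [RHS](reindex_inj (addIr (k - ord_max))) /=; apply: eq_bigr => i _.
  by rewrite !ffunE E.
by rewrite -expr2 mulr_sumr; apply: ler_sum => f _; exact: sum_open_closed.
Qed.

End Rotations.

(** * Labelled copies *)


Lemma set2_inj (T : finType) (a b c d : T) : [set a; b] = [set c; d] ->
  (a = c /\ b = d) \/ (a = d /\ b = c).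
Proof.
move=> E.
have : a \in [set c; d] by rewrite -E set21.
have : b \in [set c; d] by rewrite -E set22.
have : c \in [set a; b] by rewrite E set21.
have : d \in [set a; b] by rewrite E set22.
by case/set2P=> ->; case/set2P=> ->; case/set2P=> ?; case/set2P=> ?; subst; auto.
Qed.

Section Copies.
Variables (K : sgraph).

Definition image_graph (H : sgraph) (f : {ffun H -> K}) : {set K} * {set edge K} :=
  (f @: [set: H],
   [set e : edge K | [exists x, exists y, adj x y && (val e == [set f x; f y])]]).

Arguments image_graph {H} f.

Lemma edgeP (e : edge K) : exists x y, adj x y /\ val e = [set x; y].
Proof.
have := valP e; rewrite inE => /existsP[x /existsP[y /andP[xy /eqP E]]].
by exists x, y.
Qed.

Lemma edge_neq (e : edge K) x y : val e = [set x; y] -> x != y.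
Proof.
have [a [b [ab ->]]] := edgeP e => /set2_inj E.
have anb : a != b by apply: contraTneq ab => ->; rewrite adj_irr.
by case: E => -[<- <-] //; rewrite eq_sym.
Qed.

Lemma copies_image_graph (H : sgraph) S : S \in copies K H ->
  exists2 f : {ffun H -> K}, injectiveb f & S = image_graph f.
Proof.
rewrite inE => /andP[sub /existsP[f /and3P[fi /eqP fS /forallP fadj]]].
exists f => //; case: S sub fS fadj => S1 S2 /= /forall_inP sub fS fadj.
congr pair; [exact: esym|apply/setP => e; rewrite inE; apply/idP/existsP].
  move=> eS; have [a [b [_ E]]] := edgeP e; have := sub _ eS.
  rewrite E -fS subUset !sub1set => /andP[/imsetP[x _ ax] /imsetP[y _ bY]].
  exists x; apply/existsP; exists y; rewrite ax bY eqxx andbT.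
  rewrite (eqP (forallP (fadj x) y)); apply/existsP; exists e.
  by rewrite eS /= E ax bY.
case=> x /existsP[y /andP[xy /eqP E]]; move: xy.
rewrite (eqP (forallP (fadj x) y)) => /existsP[e' /andP[e'S /eqP E']].
by have -> : e = e' by apply: val_inj; rewrite E E'.
Qed.

Variables (R : realType) (mu : edge K -> R).
Hypothesis mu_ge0 : forall e, 0 <= mu e.

Lemma weight_ge0 S : 0 <= weight mu S.
Proof. exact: prodr_ge0. Qed.

(** Composing one embedding of a copy with the automorphisms [s a] gives [#|A|] different embeddings
    with the same image. *)
Lemma beta_automorphisms (H : sgraph) (A : finType) (s : A -> H -> H) :
  (forall a, injective (s a)) ->
  (forall a x y, adj (s a x) (s a y) = adj x y) ->
  (forall a b, s a =1 s b -> a = b) ->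
  #|A|%:R * beta mu H <= \sum_(f : {ffun H -> K} | injectiveb f) weight mu (image_graph f).
Proof.
move=> s_inj s_adj s_dist.
rewrite (partition_big (@image_graph H) predT) //= /beta mulr_sumr.
rewrite [leRHS](bigID (mem (copies K H))) /= -[leLHS]addr0; apply: lerD; last first.
  by apply: sumr_ge0 => S _; apply: sumr_ge0 => f _; exact: weight_ge0.
apply: ler_sum => S /copies_image_graph[f0 f0i SE].
pose F a : {ffun H -> K} := [ffun x => f0 (s a x)].
have F_inj : injective F.
  move=> a b /ffunP E; apply: s_dist => x; have := E x.
  by rewrite !ffunE => /(injectiveP _ f0i).
have F_img a : image_graph (F a) = S.
  have [s' s'K sK'] := injF_bij (s_inj a).
  rewrite SE; congr pair; apply/setP => z; rewrite ?inE.
    apply/imsetP/imsetP => -[x _ ->]; first by exists (s a x); rewrite ?ffunE ?inE.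
    by exists (s' x); rewrite ?ffunE ?sK' ?inE.
  apply/existsP/existsP => -[x /existsP[y /andP[xy /eqP E]]].
    exists (s a x); apply/existsP; exists (s a y).
    by rewrite s_adj xy E !ffunE eqxx.
  exists (s' x); apply/existsP; exists (s' y).
  by rewrite -(s_adj a) !ffunE !sK' xy E eqxx.
rewrite mulr_natl -[#|A|]cardsT -(card_imset _ F_inj) -sumr_const.
rewrite [leRHS](bigID (mem (F @: setT))) /= -[leLHS]addr0; apply: lerD; last first.
  by apply: sumr_ge0 => f _; exact: weight_ge0.
rewrite le_eqVlt; apply/orP; left; apply/eqP.
apply: eq_big => [f|f /imsetP[a _ ->]]; last by rewrite F_img.
apply/idP/andP => [/[dup] fF /imsetP[a _ ->]|[]//]; split; last first.
  by apply/imsetP; exists a.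
rewrite F_img eqxx andbT; apply/injectiveP => x y.
by rewrite !ffunE => /(injectiveP _ f0i) /s_inj.
Qed.

(** As a sum it makes sense for every pair of vertices: it is empty on the diagonal and has at most
    one term elsewhere. *)
Definition emass x y : R := \sum_(e : edge K | val e == [set x; y]) mu e.

Lemma emass_sym x y : emass x y = emass y x.
Proof. by apply: eq_bigl => e; rewrite setUC. Qed.

Lemma emass_diag x : emass x x = 0.
Proof.
by apply: big1 => e /eqP /edge_neq; rewrite eqxx.
Qed.

Lemma emass_ge0 x y : 0 <= emass x y.
Proof. exact: sumr_ge0. Qed.

Lemma emassE (e : edge K) x y : val e = [set x; y] -> emass x y = mu e.
Proof.
by move=> E; rewrite /emass (big_pred1 e) // => e'; rewrite -E -val_eqE.
Qed.

Lemma emass_sum : \sum_x \sum_y emass x y = 2 * \sum_e mu e.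
Proof.
rewrite pair_big /= /emass (exchange_big_dep predT) //= mulr_sumr.
apply: eq_bigr => e _; have [a [b [_ E]]] := edgeP e.
have ab := edge_neq _ _ _ E.
rewrite (eq_bigl (mem [set (a, b); (b, a)])) => [|[x y]].
  by rewrite sumr_const cards2 xpair_eqE (negPf ab) mulr_natl.
rewrite !inE !xpair_eqE E; apply/eqP/orP => [/set2_inj[] [-> ->]|[] /andP[/eqP-> /eqP->] //].
- by left; rewrite !eqxx.
- by right; rewrite !eqxx.
by rewrite setUC.
Qed.

Hypothesis K_complete : complete K.

Lemma edge_of x y : x != y -> exists e : edge K, val e == [set x; y].
Proof.
move=> xy; have E : [set x; y] \in edges K.
  by rewrite inE; apply/existsP; exists x; apply/existsP; exists y; rewrite K_complete //=.
by exists (exist (fun e => e \in edges K) _ E).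
Qed.

(** Enumerating the edges of [S] without repetition turns sums and products over an edge set into
    indexed ones. *)
Lemma weight_param (I : finType) (a b : I -> K)
    (S : {set K} * {set edge K}) :
  (forall i, a i != b i) ->
  (forall i j, [set a i; b i] = [set a j; b j] -> i = j) ->
  (forall e : edge K, (e \in S.2) = [exists i, val e == [set a i; b i]]) ->
  [/\ weight mu S = \prod_i emass (a i) (b i),
      \sum_(e in S.2) mu e = \sum_i emass (a i) (b i) & #|S.2| = #|I|].
Proof.
move=> ab abi SE.
have [eps epsP] := fin_all_exists (fun i => edge_of _ _ (ab i)).
have epsE i : val (eps i) = [set a i; b i] by exact/eqP/epsP.
have eps_inj : injective eps.
  by move=> i j E; apply: abi; rewrite -!epsE E.
have E : S.2 = eps @: setT.
  apply/setP => e; rewrite SE; apply/existsP/imsetP => [[i /eqP E]|[i _ ->]].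
    by exists i => //; apply: val_inj; rewrite E epsE.
  by exists i.
rewrite /weight E card_imset // cardsT.
split=> //; (rewrite big_imset => [|i j _ _ /eps_inj //]);
by apply: eq_big => [i|i _]; rewrite ?inE // (emassE (eps i)) // epsE.
Qed.

End Copies.

Arguments image_graph {K H} f.

(** * Cycles and paths *)


Lemma cycle_adjE p (i j : 'I_p.+3) : cycle_adj i j = (j == i + 1) || (i == j + 1).
Proof.
rewrite /cycle_adj -!val_eqE /= !modnDmr !addn1; apply/andP/idP => [[]//|E].
split=> //; apply: contraTneq E => ->; rewrite orbb.
case: (ltngtP j.+1 p.+3) => [lt|gt|jp]; last first.
- by rewrite jp modnn; apply/eqP => j0; move: jp; rewrite j0.
- by have := ltn_ord j; rewrite ltnNge -ltnS gt.
by rewrite modn_small // neq_ltn ltnSn.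
Qed.

Lemma ord_add11_neq p (i : 'I_p.+3) : i + 1 + 1 != i.
Proof. by rewrite -addrA -[X in _ != X]addr0 (inj_eq (addrI i)) -val_eqE. Qed.

Section CyclesAndPaths.
Variables (K : sgraph) (R : realType) (mu : edge K -> R) (x0 : K).
Hypotheses (mu_ge0 : forall e, 0 <= mu e) (K_complete : complete K).

Local Notation g := (emass K R mu).
Local Notation path_sum := (path_sum R K g x0).
Local Notation leaf := (leaf R K g x0).

Lemma cycle_edges p (f : {ffun cycle_graph p.+3 -> K}) (e : edge K) :
  (e \in (image_graph f).2) = [exists i : 'I_p.+3, val e == [set f i; f (i + 1)]].
Proof.
rewrite inE; apply/existsP/existsP => [[x /existsP[y /andP[]]]|[i E]].
  rewrite /= cycle_adjE => /orP[]/eqP-> E; first by exists x.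
  by exists y; rewrite setUC.
by exists i; apply/existsP; exists (i + 1); rewrite E /= cycle_adjE eqxx.
Qed.

Lemma weight_cycle p (f : {ffun cycle_graph p.+3 -> K}) : injectiveb f ->
  [/\ weight mu (image_graph f) = closed_weight R K g p f,
      \sum_(e in (image_graph f).2) mu e = \sum_i g (f i) (f (i + 1))
    & #|(image_graph f).2| = p.+3].
Proof.
move=> /injectiveP fi.
have [] := weight_param K R mu K_complete 'I_p.+3 f (fun i => f (i + 1)) (image_graph f).
- move=> i; rewrite (inj_eq fi) -[X in X != _]addr0 (inj_eq (addrI i)).
  by rewrite -val_eqE.
- move=> i j /set2_inj[[/fi //]|[/fi -> /fi /eqP]].
  by rewrite (negPf (ord_add11_neq _ _)).
- exact: cycle_edges.
by rewrite card_ord.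
Qed.

Lemma beta_cycle_le p : 2 * p.+3%:R * beta mu (cycle_graph p.+3) <=
  \sum_(f : {ffun 'I_p.+3 -> K} | injectiveb f) closed_weight R K g p f.
Proof.
(* The dihedral group: reflections for [true], rotations for [false]. *)
pose s (a : bool * 'I_p.+3) (i : cycle_graph p.+3) : cycle_graph p.+3 :=
  if a.1 then a.2 - i else a.2 + i.
have := beta_automorphisms K R mu mu_ge0 (cycle_graph p.+3) _ s.
rewrite card_prod card_bool card_ord natrM.
rewrite (eq_bigr (closed_weight R K g p)) => [|f fi]; last by have [] := weight_cycle _ f fi.
apply.
- by move=> [[] k] i j /addrI // /oppr_inj.
- move=> [[] k] i j; rewrite /= !cycle_adjE /s /= -!addrA !(inj_eq (addrI k)) //.
  have N (a b : 'I_p.+3) : (- a == - b + 1) = (b == a + 1).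
    by rewrite -(inj_eq (addrI (b + a))) addrK addrA [b + a]addrC addrK.
  by rewrite !N orbC.
(* The image of 0 determines the shift, and the image of 1 the orientation, since [-1] and [1]
   differ modulo [p.+3]. *)
- move=> [b k] [b' k'] E; have := E 0; have := E 1; rewrite /s /=.
  have N : (- 1 == 1 :> 'I_p.+3) = false.
    by rewrite -val_eqE /= !modn_small ?subSS.
  case: b b' E => [] [] _; rewrite ?subr0 ?addr0 => /eqP E1 E0; rewrite ?E0 //;
  by move: E1; rewrite E0 (inj_eq (addrI _)) ?N // eq_sym N.
Qed.

Lemma path_edges m (f : {ffun path_graph m.+1 -> K}) (e : edge K) :
  (e \in (image_graph f).2) =
  [exists i : 'I_m, val e == [set f (widen_ord (leqnSn m) i); f (lift ord0 i)]].
Proof.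
rewrite inE; apply/existsP/existsP => [[x /existsP[y /andP[]]]|[i E]].
  wlog: x y / y == x.+1 :> nat.
    move=> W /[dup] /orP[yx|xy]; first exact: W.
    by rewrite adj_sym setUC; apply: W.
  move=> /eqP yx _ E; have xm : (x < m)%N by rewrite -ltnS -yx.
  exists (Ordinal xm); apply: etrans E; congr (_ == [set f _; f _]); exact: val_inj.
exists (widen_ord (leqnSn m) i); apply/existsP; exists (lift ord0 i).
by rewrite E /= /path_adj eqxx.
Qed.

Lemma weight_path m (f : {ffun path_graph m.+1 -> K}) : injectiveb f ->
  weight mu (image_graph f) = path_weight R K g x0 (mktuple f).
Proof.
move=> /injectiveP fi; rewrite path_weight_mktuple.
have [] := weight_param K R mu K_complete 'I_m (fun i => f (widen_ord (leqnSn m) i))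
  (fun i => f (lift ord0 i)) (image_graph f) => //.
- by move=> i; rewrite (inj_eq fi) -val_eqE /= neq_ltn ltnSn.
- move=> i j /set2_inj[[/fi/(congr1 val)/= ij _]|[/fi/(congr1 val)/= + /fi/(congr1 val)/=]].
    exact: val_inj.
  by rewrite /bump /=; lia.
- exact: path_edges.
Qed.

Lemma beta_path_le m : 2 * beta mu (path_graph m.+2) <= path_sum m.+1 (fun=> 1).
Proof.
pose s (b : bool) (i : path_graph m.+2) : path_graph m.+2 := if b then rev_ord i else i.
have := beta_automorphisms K R mu mu_ge0 (path_graph m.+2) _ s.
rewrite card_bool (eq_bigr _ (fun f fi => weight_path _ f fi)).
rewrite -(sum_uniq_tuple _ _ _ (fun t => path_weight R K g x0 t)).
have -> : \sum_(t : m.+2.-tuple K | uniq t) path_weight R K g x0 t = path_sum m.+1 (fun=> 1).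
  by apply: eq_bigr => t _; rewrite mulr1.
apply.
- by move=> [] i j //= /rev_ord_inj.
- move=> [] i j //=; rewrite /path_adj /=; have := ltn_ord i; have := ltn_ord j.
  by move=> jm im; apply/orP/orP; lia.
- by move=> [] [] E //; have /(congr1 val) := E ord0.
Qed.

(** Each of the two boundary terms of [leaf] sums to the weight of all paths with one more edge, so
    their half-sum does too. *)
Lemma copies_le_leaf p :
  \sum_(f : {ffun 'I_p.+3 -> K} | injectiveb f) closed_weight R K g p f
  + path_sum p.+3 (fun=> 1) <= path_sum p.+2 leaf.
Proof.
rewrite path_sumD path_sumZ path_sumD path_sum_ext_left path_sum_ext_right.
apply: lerD; last by lra.
by apply: closed_le_path_sum => x y; exact: emass_ge0.
Qed.

End CyclesAndPaths.

(** * The equality case *)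


(** Without isolated vertices a copy is determined by its edges, so copies can be compared through
    their edge sets. *)
Lemma image_graph_vertices (K H : sgraph) (f : {ffun H -> K}) :
  complete K -> injectiveb f -> (forall x : H, exists y, adj x y) ->
  (image_graph f).1 = \bigcup_(e in (image_graph f).2) val e.
Proof.
move=> K_complete /injectiveP fi nbr; apply/eqP; rewrite eqEsubset; apply/andP; split.
  apply/subsetP => _ /imsetP[x _ ->]; have [y xy] := nbr x.
  have fxy : f x != f y by rewrite (inj_eq fi); apply: contraTneq xy => ->; rewrite adj_irr.
  have [e /eqP E] := edge_of K K_complete _ _ fxy.
  apply/bigcupP; exists e; last by rewrite E set21.
  by rewrite inE; apply/existsP; exists x; apply/existsP; exists y; rewrite xy E eqxx.
apply/bigcupsP => e; rewrite inE => /existsP[x /existsP[y /andP[_ /eqP->]]].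
by rewrite subUset !sub1set !imset_f.
Qed.

Lemma card_image_graph (K H : sgraph) (f : {ffun H -> K}) :
  injectiveb f -> #|(image_graph f).1| = #|H|.
Proof. by move=> /injectiveP fi; rewrite card_imset // cardsT. Qed.

Lemma cycle_neighbour p (x : cycle_graph p.+3) : exists y, adj x y.
Proof. by exists (x + 1 : 'I_p.+3); rewrite /= cycle_adjE eqxx. Qed.

Lemma path_neighbour m (x : path_graph m.+2) : exists y, adj x y.
Proof.
have [lt|ge] := ltnP x m.+1.
  by exists (inord x.+1); rewrite /= /path_adj inordK ?eqxx.
exists (inord m); rewrite /= /path_adj inordK; last by rewrite ltnS leqnSn.
have := ltn_ord x; rewrite ltnS => le.
by rewrite (eqP (_ : val x == m.+1)) ?eqxx ?orbT // eqn_leq le ge.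
Qed.

Section Support.
Variables (K : sgraph) (R : realType) (mu : edge K -> R).
Hypotheses (K_complete : complete K).
Variables (p : nat) (C : {set K} * {set edge K}).
Hypotheses (C_copy : C \in copies K (cycle_graph p.+3)).
Hypotheses (mu_off : forall e, e \notin C.2 -> mu e = 0).

Lemma card_cycle_edges S : S \in copies K (cycle_graph p.+3) -> #|S.2| = p.+3.
Proof.
by case/copies_image_graph => f fi ->; have [] := weight_cycle K R mu K_complete _ _ fi.
Qed.

Lemma weight_support (S : {set K} * {set edge K}) : weight mu S != 0 -> S.2 \subset C.2.
Proof.
move=> w; apply/subsetP => e eS; apply: contraNT w => /mu_off e0.
by rewrite /weight (bigD1 e) //= e0 mul0r.
Qed.

(** A cycle of nonzero weight has its [p.+3] edges among the [p.+3] edges of [C], hence is [C]. *)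
Lemma beta_cycle_supported : beta mu (cycle_graph p.+3) = weight mu C.
Proof.
rewrite /beta (bigD1 C) //= big1 ?addr0 // => S /andP[S_copy]; apply: contraNeq => w.
have E : S.2 = C.2.
  by apply/eqP; rewrite eqEcard weight_support //= !card_cycle_edges.
move: E; have [f fi ->] := copies_image_graph _ _ _ S_copy.
have [f' fi' ->] := copies_image_graph _ _ _ C_copy => E.
rewrite [image_graph f]surjective_pairing [image_graph f']surjective_pairing.
rewrite !image_graph_vertices // ?E //; exact: cycle_neighbour.
Qed.

(** A path of nonzero weight would fit [p.+4] vertices into the [p.+3] vertices of [C]. *)
Lemma beta_path_supported : beta mu (path_graph p.+4) = 0.
Proof.
apply: big1 => S S_copy; apply/eqP; apply: contraT => /weight_support.
have [f fi ->] := copies_image_graph _ _ _ S_copy.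
have [f' fi' ->] := copies_image_graph _ _ _ C_copy => sub.
have := card_image_graph _ _ _ fi; have := card_image_graph _ _ _ fi'.
rewrite !image_graph_vertices //; try exact: cycle_neighbour; try exact: path_neighbour.
rewrite !card_ord => c' c.
suff /subset_leq_card : \bigcup_(e in (image_graph f).2) val e \subset
    \bigcup_(e in (image_graph f').2) val e by rewrite c c' ltnn.
by apply/bigcupsP => e /(subsetP sub) eC; apply: bigcup_sup.
Qed.

End Support.

Section Equality.
Variables (K : sgraph) (R : realType) (mu : edge K -> R) (x0 : K) (p : nat).
Hypotheses (mu_ge0 : forall e, 0 <= mu e) (mu_sum : \sum_e mu e = 1).
Hypothesis (K_complete : complete K).

Local Notation g := (emass K R mu).
Local Notation path_weight := (path_weight R K g x0).
Local Notation path_sum := (path_sum R K g x0).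
Local Notation leaf := (leaf R K g x0).
Local Notation slack := (slack R K g x0).
Local Notation cyc := (cyc R K g x0).
Local Notation mass := (mass R K g).
Local Notation inner := (inner R K g).
Local Notation touched := (touched R K g).

Let g_sym := emass_sym K R mu.
Let g_diag := emass_diag K R mu.
Let g_ge0 := emass_ge0 K R mu mu_ge0.

Let g_sum : \sum_x \sum_y g x y = 2.
Proof. by rewrite emass_sum mu_sum mulr1. Qed.

Lemma path_sum_ge0 q h : (forall s, size s = q.+1 -> uniq s -> 0 <= h s) ->
  0 <= path_sum q h.
Proof.
move=> h0; apply: sumr_ge0 => t ut.
by rewrite mulr_ge0 ?path_weight_ge0 ?h0 ?size_tuple.
Qed.

Lemma path_sum_eq0 q h (t : q.+1.-tuple K) :
  (forall s, size s = q.+1 -> uniq s -> 0 <= h s) -> path_sum q h = 0 ->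
  uniq t -> path_weight t != 0 -> h t = 0.
Proof.
move=> h0 E ut w0; have := psumr_eq0P _ E ut.
move=> /(_ _)/eqP; rewrite mulf_eq0 (negPf w0) /= => H; apply/eqP; apply: H => s us.
by rewrite mulr_ge0 ?path_weight_ge0 ?h0 ?size_tuple.
Qed.

Lemma cycle_path_slack_le :
  2 * p.+3%:R * beta mu (cycle_graph p.+3) + path_sum p.+3 (fun=> 1)
  + p.+3%:R * path_sum p.+2 (fun s => leaf s * slack s) <= 2 / p.+3%:R ^+ p.+2.
Proof.
apply: le_trans (leaf_bound R K g x0 g_sym g_diag g_ge0 g_sum p.+2 isT).
rewrite lerD2r; apply: le_trans (copies_le_leaf K R mu x0 mu_ge0 p).
by rewrite lerD2r beta_cycle_le.
Qed.

Lemma beta_ge0 (H : sgraph) : 0 <= beta mu H.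
Proof. by apply: sumr_ge0 => S _; exact: weight_ge0. Qed.

Lemma leaf_slack_ge0 s : size s = p.+3 -> uniq s -> 0 <= leaf s * slack s.
Proof.
move=> ss us; rewrite mulr_ge0 ?leaf_ge0 // slack_ge0 // ?ss //.
Qed.

Lemma beta_cycle_path_le :
  2 * p.+3%:R * beta mu (cycle_graph p.+3) + 2 * beta mu (path_graph p.+4)
    <= 2 / p.+3%:R ^+ p.+2.
Proof.
apply: le_trans cycle_path_slack_le; rewrite -[leLHS]addr0 lerD //.
  by rewrite lerD2l beta_path_le.
by rewrite mulr_ge0 // path_sum_ge0 // => s; exact: leaf_slack_ge0.
Qed.

(** Write [b] for the path beta, [T] for the labelled path sum and [X] for the slack sum. Equality
    turns [cycle_path_slack_le] into [T + p.+3 * X <= b], while [2 * b <= T]; as all are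
    nonnegative, all vanish. *)
Lemma tight_slack :
  2 * p.+3%:R * beta mu (cycle_graph p.+3) + beta mu (path_graph p.+4)
    = 2 / p.+3%:R ^+ p.+2 ->
  [/\ beta mu (path_graph p.+4) = 0, path_sum p.+3 (fun=> 1) = 0
    & path_sum p.+2 (fun s => leaf s * slack s) = 0].
Proof.
move=> E; have := cycle_path_slack_le; rewrite -E.
have := beta_path_le K R mu x0 mu_ge0 K_complete p.+2.
have := beta_ge0 (path_graph p.+4).
have := path_sum_ge0 p.+2 _ leaf_slack_ge0.
set X := path_sum p.+2 _; set T := path_sum p.+3 _; set b := beta mu (path_graph _).
move=> X0 b0 bT le.
have mX : 0 <= p.+3%:R * X by rewrite mulr_ge0.
have : p.+3%:R * X = 0 by lra.
move=> /eqP; rewrite mulf_eq0 pnatr_eq0 /= => /eqP X0'.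
by split=> //; lra.
Qed.

(** No mass leaves the cycle, so its vertex masses add up to [2 * inner s]. Zero slack gives
    [touched s = 1] and [inner s = cyc s], and [sum_mass] becomes [2 * cyc s = 1 + cyc s]. *)
Lemma tight_cycle_mass (f : {ffun 'I_p.+3 -> K}) :
  injectiveb f -> closed_weight R K g p f != 0 ->
  path_sum p.+3 (fun=> 1) = 0 -> path_sum p.+2 (fun s => leaf s * slack s) = 0 ->
  \sum_i g (f i) (f (i + 1)) = 1.
Proof.
move=> fi w0 T0 X0; pose rot k : {ffun 'I_p.+3 -> K} := [ffun i => f (i + k)].
have uniq_mk (h : {ffun 'I_p.+3 -> K}) : injectiveb h -> uniq (mktuple h) by [].
have roti k : injectiveb (rot k).
  by apply/injectiveP => i j; rewrite !ffunE => /(injectiveP _ fi) /addIr.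
have g_neq0 i : g (f i) (f (i + 1)) != 0.
  by apply: contraNneq w0 => g0; rewrite /closed_weight (bigD1 i) //= g0 mul0r.
have wrot k : path_weight (mktuple (rot k)) != 0.
  rewrite path_weight_open; apply/prodf_neq0 => i _.
  by rewrite !ffunE addrAC g_neq0.
(* Rotation by [i + 1] puts [f i] last on a path of nonzero weight, which has no extension of
   positive mass. *)
have boundary i v : v \notin mktuple f -> g (f i) v = 0.
  move=> vf; have E0 := path_sum_ext_right R K g x0 p.+2 (fun=> 1).
  rewrite T0 in E0.
  have Er s : size s = p.+3 -> uniq s -> 0 <= ext_right R K g x0 (fun=> 1) s.
    by move=> _ _; apply: ext_right1_ge0.
  have := path_sum_eq0 _ _ (mktuple (rot (i + 1))) Er E0 (uniq_mk _ (roti _)) (wrot _).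
  move=> H; have {H} : g (last x0 (mktuple (rot (i + 1)))) v * 1 = 0.
    apply: (psumr_eq0P _ H) => [u _|]; first by rewrite mulr1 g_ge0.
    apply: contra vf => /tnthP[j]; rewrite tnth_mktuple ffunE => ->.
    by apply/tnthP; exists (j + (i + 1)); rewrite tnth_mktuple.
  have max1 : ord_max + 1 = 0 :> 'I_p.+3.
    by apply: val_inj; rewrite /= modnDmr addn1 modnn.
  rewrite mulr1 (last_nth x0) size_tuple /= (nth_mktuple (rot (i + 1)) x0 ord_max).
  by rewrite ffunE addrCA max1 addr0.
have := path_sum_eq0 _ _ (mktuple f) leaf_slack_ge0 X0 (uniq_mk _ fi).
have wf : path_weight (mktuple f) != 0.
  by rewrite path_weight_open; apply/prodf_neq0 => i _; exact: g_neq0.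
move=> /(_ wf) /eqP; rewrite mulf_eq0.
set s := tval (mktuple f).
have ss : size s = p.+3 by rewrite size_tuple.
have us : uniq s by exact: uniq_mk.
have cycE : cyc s = \sum_i g (f i) (f (i + 1)) by exact: cyc_mktuple.
have c0 : 0 < cyc s.
  rewrite cycE (bigD1 ord0) //= ltr_wpDr ?sumr_ge0 //.
  by rewrite lt_def g_neq0 g_ge0.
have -> : (leaf s == 0) = false.
  apply/negbTE; rewrite gt_eqF // /leaf ss ltr_wpDr // ?divr_gt0 //.
  by rewrite mulr_ge0 ?invr_ge0 // addr_ge0 ?ext_left1_ge0 ?ext_right1_ge0.
rewrite /= /slack ss mulf_eq0 invr_eq0 pnatr_eq0 orbF /= => /eqP E.
have I0 : cyc s <= inner s by apply: inner_ge_cyc; rewrite ?ss.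
have H1 : touched s <= 1 by exact: touched_le1.
have H0 : 0 <= p.+2%:R * (1 - touched s) by rewrite mulr_ge0 // subr_ge0.
have Ic : inner s = cyc s by lra.
have Ht : touched s = 1.
  have /eqP : p.+2%:R * (1 - touched s) = 0 by lra.
  rewrite mulf_eq0 pnatr_eq0 /=; lra.
have := sum_mass R K g x0 g_sym g_sum s us; rewrite Ht Ic.
have -> : \sum_(i < size s) mass (nth x0 s i) = 2 * inner s.
  rewrite -(sum_nth_uniq K x0 R mass s us) /inner mulVKf ?pnatr_eq0 //.
  apply: eq_bigr => x /tnthP[i ->]; rewrite tnth_mktuple.
  rewrite /mass (bigID (mem s)) /= [X in _ + X]big1 ?addr0 // => v.
  exact: boundary.
rewrite Ic -cycE; lra.
Qed.

End Equality.

Lemma prob_ge0 (R : realType) (K : sgraph) (mu : edge K -> R) :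
  edge_prob_measure mu -> forall e, 0 <= mu e.
Proof. by case=> mu01 _ e; have /andP[] := mu01 e. Qed.

(** Total mass 1 forces an edge, whose endpoint serves as the default vertex [x0]. *)
Lemma prob_vertex (R : realType) (K : sgraph) (mu : edge K -> R) :
  edge_prob_measure mu -> exists x : K, true.
Proof.
case=> mu01 mu1; have [e _] : exists e, true && (0 < mu e).
  apply: psumr_neq0P => [e _|]; first by have /andP[] := mu01 e.
  by rewrite mu1; apply/eqP; exact: oner_neq0.
by have [x _] := edgeP K e; exists x.
Qed.

Lemma equality_uniform (R : realType) (K : sgraph) (p : nat) (mu : edge K -> R) :
  complete K -> edge_prob_measure mu ->
  2 * p.+3%:R * beta mu (cycle_graph p.+3) + beta mu (path_graph p.+4)
    = 2 / p.+3%:R ^+ p.+2 ->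
  exists2 C : {set K} * {set edge K}, C \in copies K (cycle_graph p.+3) &
    forall e : edge K, mu e = if e \in C.2 then p.+3%:R^-1 else 0.
Proof.
move=> K_complete mu_prob E; have mu_ge0 := prob_ge0 _ _ _ mu_prob.
have [x0 _] := prob_vertex _ _ _ mu_prob; have mu_sum := mu_prob.2.
have [b0 T0 X0] := tight_slack K R mu x0 p mu_ge0 mu_sum K_complete E.
have m0 : (0 : R) < p.+3%:R ^+ p.+2 by rewrite exprn_gt0.
rewrite b0 addr0 in E.
have betaC : beta mu (cycle_graph p.+3) = (p.+3%:R ^+ p.+3)^-1.
  apply: (@mulfI _ (2 * p.+3%:R)); first by rewrite mulf_neq0 // pnatr_eq0.
  have -> : (p.+3%:R ^+ p.+3)^-1 = p.+3%:R^-1 * (p.+3%:R ^+ p.+2)^-1 :> R.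
    by rewrite exprS invfM.
  by rewrite E -[RHS]mulrA mulVKf // pnatr_eq0.
have [C /andP[C_copy C_gt0]] : exists C, (C \in copies K (cycle_graph p.+3)) && (0 < weight mu C).
  apply: psumr_neq0P => [C _|]; first exact: weight_ge0.
  by apply/eqP; rewrite -/(beta _ _) betaC invr_neq0 // expf_neq0 // pnatr_eq0.
have [f fi CE] := copies_image_graph _ _ _ C_copy.
have [wE sE _] := weight_cycle K R mu K_complete _ _ fi.
have C2_sum : \sum_(e in C.2) mu e = 1.
  rewrite CE sE; apply: (tight_cycle_mass K R mu x0 p) => //.
  by rewrite -wE -CE lt0r_neq0.
have mu_off e : e \notin C.2 -> mu e = 0.
  move=> eC; apply: (psumr_eq0P (P := fun e => e \notin C.2)) eC => //.
  by move: mu_sum; rewrite (bigID (mem C.2)) /= C2_sum -[RHS]addr0 => /addrI.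
exists C => // e; case: ifPn => [eC|/mu_off //].
have wC : weight mu C = (p.+3%:R ^+ p.+3)^-1.
  by rewrite -betaC (beta_cycle_supported K R mu K_complete p C).
have C2_card := card_cycle_edges _ R mu K_complete _ _ C_copy.
(* The masses on [C] have mean [1 / p.+3] and product the [p.+3]-th power of that mean, so AM-GM is
   tight and they are all equal. *)
have AGM : {in C.2, forall e, 0 <= mu e} by [].
have := leif_AGM AGM; rewrite -/(weight mu C) wC C2_sum C2_card div1r exprVn.
case=> _ /esym; rewrite eqxx => /forall_inP/(_ e eC)/forall_inP eqC.
move: C2_sum; rewrite (eq_bigr (fun=> mu e)) => [|e' e'C]; last by rewrite (eqP (eqC _ e'C)).
rewrite sumr_const C2_card => H; apply: (@mulIf _ p.+3%:R).
  by rewrite pnatr_eq0.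
by rewrite mulr_natr H mulVf // pnatr_eq0.
Qed.

Lemma uniform_equality (R : realType) (K : sgraph) (p : nat) (mu : edge K -> R)
  (C : {set K} * {set edge K}) :
  complete K -> C \in copies K (cycle_graph p.+3) ->
  (forall e : edge K, mu e = if e \in C.2 then p.+3%:R^-1 else 0) ->
  2 * p.+3%:R * beta mu (cycle_graph p.+3) + beta mu (path_graph p.+4)
    = 2 / p.+3%:R ^+ p.+2.
Proof.
move=> K_complete C_copy muE.
have mu_off e : e \notin C.2 -> mu e = 0 by move=> eC; rewrite muE (negPf eC).
rewrite (beta_path_supported K R mu K_complete p C) // addr0.
rewrite (beta_cycle_supported K R mu K_complete p C) // /weight.
rewrite (eq_bigr (fun=> p.+3%:R^-1)) => [|e eC]; last by rewrite muE eC.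
rewrite prodr_const (card_cycle_edges _ R mu K_complete _ _ C_copy) exprS.
by rewrite -mulrA mulVKf ?pnatr_eq0 // exprVn.
Qed.

Theorem theorem1p3 (R : realType) :
  (forall (K : sgraph) (m : nat) (mu : edge K -> R),
     complete K -> (3 <= m)%N -> edge_prob_measure mu ->
     2 * m%:R * beta mu (cycle_graph m) + 2 * beta mu (path_graph m.+1)
       <= 2 / m%:R ^+ (m - 1)) /\
  (forall (K : sgraph) (m : nat) (mu : edge K -> R),
     complete K -> (3 <= m)%N -> edge_prob_measure mu ->
     (2 * m%:R * beta mu (cycle_graph m) + beta mu (path_graph m.+1)
        = 2 / m%:R ^+ (m - 1)
      <->
      exists2 C : {set K} * {set edge K},
        C \in copies K (cycle_graph m) &
        forall e : edge K, mu e = if e \in C.2 then m%:R^-1 else 0)).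
Proof.
split=> K [|[|[|p]]] // mu K_complete _ mu_prob; rewrite subn1.
  have [x0 _] := prob_vertex _ _ _ mu_prob.
  exact: (beta_cycle_path_le K R mu x0 p (prob_ge0 _ _ _ mu_prob) mu_prob.2 K_complete).
split=> [|[C C_copy muE]]; first exact: equality_uniform.
exact: uniform_equality muE.
Qed.
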